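(* Let $L\in[L_0,\infty)\setminus E$. Set $$\mathscr{S}=\{L/k:\ k\in\mathbb{N},\ k\ge1,\ L/k\ge L_0,\ L/k\notin E\}.$$ Then the number of one-dimensional families of solutions (of period $L$) to $$\tfrac12u_x^2=W(u)+c_1u+c_2,\qquad (c_1,c_2)\in\mathcal{C},$$ with zero mean is bounded by the cardinality of $$\bigcup_{L/k\in\mathscr{S}}\mathcal{P}_{L/k},$$ which is finite.
   Context: $W(v)=\frac14(v^2-1)^2$; for $c=(c_1,c_2)$, $P_c(u)=2(W(u)+c_1u+c_2)$. $\mathcal{C}$ is the set of $(c_1,c_2)$ with $c_2\in(-\frac14,0)$ for which $P_c$ has four distinct real roots $u_1<u_m<0<u_M<u_2$. Solutions are smooth and nonconstant; a one-dimensional family is a translation orbit $\{u(\cdot+s):s\in[0,L)\}$ of a nonconstant solution. Principal period means smallest positive period. For $\ell>0$, $\mathcal{P}_\ell$ is the set of $(c_1,c_2)\in\mathcal{C}$ for which there is a solution of $\frac12u_x^2=W(u)+c_1u+c_2$ with principal period $\ell$ and zero mean, i.e. with $\int_{u_m}^{u_M}\frac{u\,du}{\sqrt{P_c(u)}}=0$ where $u_m=\min u$, $u_M=\max u$. Let $g_1(c)=\int_{u_m}^{u_M}\frac{du}{\sqrt{P_c(u)}}$ on $\mathcal{C}$, let $Z$ be its (Lebesgue null) set of critical values, and $E=Z\cup\{2k\pi:k\ge1\}$. $L_0>0$ is a constant such that: for $0<\ell<L_0$ there is no zero-mean solution with principal period $\ell$; and for $\ell\in[L_0,\infty)\setminus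 E$ the set $\mathcal{P}_\ell$ is non-empty and finite. *)

(* Defs.v *)
From HB Require Import structures.
From mathcomp Require Import all_boot all_order all_algebra.
From mathcomp Require Import all_classical all_reals all_analysis.

Set Implicit Arguments.
Unset Strict Implicit.
Unset Printing Implicit Defensive.

Import Order.TTheory GRing.Theory Num.Theory.
Import numFieldNormedType.Exports.

Local Open Scope classical_set_scope.
Local Open Scope ring_scope.

Definition W (R : realType) (v : R) : R := (v ^+ 2 - 1) ^+ 2 / 4.

Definition Pc (R : realType) (c : R * R) (u : R) : R :=
  2 * (W u + c.1 * u + c.2).

(* As [Pc c] is a quartic, [u1, um, uM, u2] are all of its roots. *)
Definition Cset (R : realType) : set (R * R) :=
  [set c | - 4^-1 < c.2 < 0 /\
     exists u1 um uM u2 : R,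
       [/\ u1 < um < 0, 0 < uM < u2,
           Pc c u1 = 0 /\ Pc c um = 0 & Pc c uM = 0 /\ Pc c u2 = 0]].

(* On [Cset R] these are the two inner roots; elsewhere they are junk. *)
Definition um (R : realType) (c : R * R) : R :=
  sup [set u : R | u < 0 /\ Pc c u = 0].
Definition uM (R : realType) (c : R * R) : R :=
  inf [set u : R | 0 < u /\ Pc c u = 0].

Definition g1 (R : realType) (c : R * R) : R :=
  \int[lebesgue_measure]_(u in `]um c, uM c[) (Num.sqrt (Pc c u))^-1.

(* [Cset R] is open, so the values of [g1] outside it do not affect ['d g1 c]. *)
Definition critical_values (R : realType) : set R :=
  [set g1 c | c in [set c : R * R | [/\ Cset c, differentiable (@g1 R) c
                     & forall v : R * R, 'd (@g1 R) c v = 0]]].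

Definition Eset (R : realType) : set R :=
  @critical_values R `|` [set 2 * k%:R * pi | k in [set k : nat | (1 <= k)%N]].

Definition smooth (R : realType) (u : R -> R) : Prop :=
  forall (n : nat) (x : R), derivable (derive1n n u) x 1.

Definition nonconstant (R : realType) (u : R -> R) : Prop :=
  ~ exists a : R, forall x, u x = a.

Definition solution (R : realType) (c : R * R) (u : R -> R) : Prop :=
  [/\ smooth u, nonconstant u
    & forall x, 2^-1 * (derive1 u x) ^+ 2 = W (u x) + c.1 * u x + c.2].

Definition has_period (R : realType) (u : R -> R) (T : R) : Prop :=
  0 < T /\ periodic u T.

Definition principal_period (R : realType) (u : R -> R) (T : R) : Prop :=
  has_period u T /\ forall T', has_period u T' -> T <= T'.

(* The mean over one period of a [T]-periodic function. *)
Definition mean (R : realType) (T : R) (u : R -> R) : R :=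
  T^-1 * \int[lebesgue_measure]_(x in `[0, T]) u x.

Definition Pset (R : realType) (l : R) : set (R * R) :=
  [set c | Cset c /\
     exists u : R -> R, [/\ solution c u, principal_period u l & mean l u = 0]].

Definition translation_orbit (R : realType) (L : R) (u : R -> R) :
    set (R -> R) :=
  [set (fun x => u (x + s)) | s in `[0, L[].

Definition families (R : realType) (L : R) : set (set (R -> R)) :=
  [set translation_orbit L u | u in
     [set u : R -> R | [/\ exists2 c, Cset c & solution c u,
                           has_period u L & mean L u = 0]]].

Definition Sset (R : realType) (L0 L : R) : set R :=
  [set l | exists k : nat,
     [/\ (1 <= k)%N, l = L / k%:R, L0 <= l & ~ Eset l]].

(* Main.v *)
(* The half-period [g1] has no critical point.  Write the roots of [Pc c] as
   [- m - d < m - r < m + r < - m + d].  After [u = m + r t] the integral is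
   [g1 c = sqrt 2 / d * K], where
   [K = int_(-1)^1 dt / sqrt ((1 - (2 m / d + (r / d) t) ^ 2) (1 - t ^ 2))]
   increases with [r / d] when [m / d] is fixed: the integrand averaged over
   [t] and [- t] does, by convexity of [y |-> (1 - y ^ 2) ^ (- 1 / 2)].  Hence
   [d * g1] is monotone along a curve on which [d] varies, and its derivative
   cannot be [g1 > 0].  So [Eset] is [{2 k pi}], and [~ Eset L] passes to every
   [L / k].

   A periodic solution oscillates between the two inner roots and solves
   [u'' = u^3 - u + c1], hence is determined up to translation by [c].  A family
   of period [L] is therefore determined by its [c], and its principal period is
   some [L / k] with zero mean over it, so [c] lies in [Pset (L / k)]. *)

Require Import Defs.
From HB Require Import structures.
From mathcomp Require Import all_boot all_order all_algebra.
From mathcomp Require Import all_classical all_reals all_analysis.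
From mathcomp Require Import measurable_realfun ring lra.

Set Implicit Arguments.
Unset Strict Implicit.
Unset Printing Implicit Defensive.

Import Order.TTheory GRing.Theory Num.Theory.
Import numFieldNormedType.Exports.

Local Open Scope classical_set_scope.
Local Open Scope ring_scope.

(** * Change of variables under affine maps and reflection *)

Section AffineChange.
Context {R : realType}.
Local Notation mu := (@lebesgue_measure R).

Let affine (m r : R) : measurableTypeR R -> measurableTypeR R := fun t => m + r * t.

Let measurable_affine (m r : R) : measurable_fun setT (affine m r).
Proof.
apply: continuous_measurable_fun => x.
apply: cvgD; first exact: cvg_cst.
by apply: cvgM; [exact: cvg_cst|exact: cvg_id].
Qed.

HB.instance Definition _ (m r : R) :=
  isMeasurableFun.Build _ _ _ _ (affine m r) (measurable_affine m r).

Lemma affine_preimage_itv (m r a b : R) (ba bb : bool) : 0 < r ->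
  (fun t => m + r * t) @^-1`
    [set` Interval (BSide ba (m + r * a)) (BSide bb (m + r * b))] =
  [set` Interval (BSide ba a) (BSide bb b)].
Proof.
move=> r0; case: ba; case: bb; apply/seteqP; split => x /=;
  by rewrite !in_itv/= ?lerD2l ?ltrD2l ?ler_pM2l ?ltr_pM2l.
Qed.

(** Lebesgue measure is [r] times its pushforward by the affine map; by uniqueness this need only be
    checked on half-open intervals. *)
Lemma ge0_integral_affine (m r a b : R) (f : R -> \bar R) : 0 < r ->
  measurable_fun `]m + r * a, m + r * b[ f ->
  (forall x, x \in `]m + r * a, m + r * b[ -> (0 <= f x)%E) ->
  (\int[mu]_(x in `](m + r * a)%R, (m + r * b)%R[) f x =
   r%:E * \int[mu]_(t in `]a, b[) f (m + r * t)%R)%E.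
Proof.
move=> r0 mf f0.
pose k : {nonneg R} := NngNum (ltW r0).
have E A : measurable A -> mu A = mscale k (pushforward mu (affine m r)) A.
  apply: lebesgue_measure_unique => _ [[c d]] _ <-.
  pose inv x := (x - m) / r.
  have invK x : m + r * inv x = x by rewrite /inv; field; lra.
  rewrite -[c]invK -[d]invK.
  transitivity (r%:E * mu ((fun t : R => m + r * t)%R @^-1`
    `](m + r * inv c)%R, (m + r * inv d)%R]))%E; last by [].
  rewrite affine_preimage_itv// !lebesgue_measure_itv/= !lte_fin ltrD2l ltr_pM2l//.
  case: ifP => _; last by rewrite mule0.
  by rewrite -!EFinD -EFinM; congr EFin; ring.
rewrite (eq_measure_integral (mscale k (pushforward mu (affine m r)))); last first.
  by move=> A mA _; exact: E.
rewrite ge0_integral_mscale//=.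
rewrite ge0_integral_pushforward//=.
  by rewrite affine_preimage_itv.
by move=> x /set_mem; exact: f0.
Qed.

Lemma ge0_integral_oppr (a : R) (f : R -> \bar R) :
  measurable_fun `]-a, a[ f ->
  (forall x, x \in `]-a, a[ -> (0 <= f x)%E) ->
  (\int[mu]_(x in `](-a)%R, a[) f x = \int[mu]_(t in `](-a)%R, a[) f (- t)%R)%E.
Proof.
move=> mf f0.
rewrite (eq_measure_integral (pushforward mu (-%R : _ -> measurableTypeR R))); last first.
  by move=> A mA _; exact/esym/lebesgue_measureN.
rewrite ge0_integral_pushforward//=.
  by rewrite opp_preimage_itvbndbnd/= opprK.
by move=> x /set_mem; exact: f0.
Qed.

End AffineChange.

(** * Convexity of [(1 - y ^ 2) ^ (- 1 / 2)] *)

Section InverseSqrt.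
Context {R : realType}.
Local Notation mu := (@lebesgue_measure R).
Implicit Types x y t : R.

(** The derivative of arcsine on []-1, 1[]. Elsewhere it is [0], since [Num.sqrt] vanishes on
    nonpositive reals and [0^-1 = 0]. *)
Definition isq y : R := (Num.sqrt (1 - y ^+ 2))^-1.

Lemma sqr_lt1 y : `|y| < 1 -> y ^+ 2 < 1.
Proof. by rewrite ltr_norml; nra. Qed.

Lemma isq_gt0 y : `|y| < 1 -> 0 < isq y.
Proof. by move=> /sqr_lt1 y1; rewrite invr_gt0 sqrtr_gt0; lra. Qed.

Lemma isq_ge0 y : 0 <= isq y.
Proof. by rewrite invr_ge0 sqrtr_ge0. Qed.

Lemma sqr_isq y : `|y| < 1 -> isq y ^+ 2 * (1 - y ^+ 2) = 1.
Proof.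
move=> /sqr_lt1 y1; rewrite exprVn sqr_sqrtr; last lra.
by rewrite mulVf//; lra.
Qed.

Lemma isq_ge1 y : `|y| < 1 -> 1 <= isq y.
Proof. by move=> y1; have := isq_gt0 y1; have := sqr_isq y1; nra. Qed.

Lemma isqN y : isq (- y) = isq y.
Proof. by rewrite /isq sqrrN. Qed.

Lemma le_isq x y : `|x| <= y -> y < 1 -> isq x <= isq y.
Proof.
move=> xy y1; have x1 : `|x| < 1 by lra.
have y1' : `|y| < 1 by rewrite ger0_norm//; have := normr_ge0 x; lra.
have x2 := sqr_lt1 x1; have y2 := sqr_lt1 y1'.
have xy2 : x ^+ 2 <= y ^+ 2 by move: xy; rewrite ler_norml; nra.
by rewrite lef_pV2 ?posrE ?sqrtr_gt0 ?ler_sqrt//; lra.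
Qed.

(* The tangent line of [s |-> s ^ (-1/2)] at [s = q ^ -2], taken at [s = 1 - y ^ 2]. *)
Lemma isq_ge_tangent q y : 0 < q -> `|y| < 1 ->
  q * (3 - q ^+ 2 * (1 - y ^+ 2)) / 2 <= isq y.
Proof.
move=> q0 y1; have p0 := isq_gt0 y1; have E := sqr_isq y1.
move: (isq y) p0 E => p p0 E.
have -> : 1 - y ^+ 2 = p^-1 ^+ 2.
  have pn : p ^+ 2 != 0 by rewrite expf_neq0// gt_eqF.
  by apply: (mulfI pn); rewrite E exprVn divff.
have : 0 <= (p - q) ^+ 2 * (2 * p + q) * p^-1 ^+ 2.
  by apply: mulr_ge0 (sqr_ge0 _); apply: mulr_ge0; [exact: sqr_ge0|lra].
have -> : (p - q) ^+ 2 * (2 * p + q) * p^-1 ^+ 2 =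
  2 * (p - q * (3 - q ^+ 2 * p^-1 ^+ 2) / 2) by field; rewrite gt_eqF.
by rewrite pmulr_rge0// subr_ge0.
Qed.

(** The tangent bound with [q = isq z] is averaged over [x] and [y]. Convexity of the square and
    [q ^ 2 * (1 - z ^ 2) = 1] then bound the average below by [q]. *)
Lemma isq_convex s x y : 0 <= s <= 1 -> `|x| < 1 -> `|y| < 1 ->
  isq (s * x + (1 - s) * y) <= s * isq x + (1 - s) * isq y.
Proof.
move=> s01 x1 y1; set z := s * x + (1 - s) * y.
have z1 : `|z| < 1.
  apply: (@le_lt_trans _ _ (Num.max `|x| `|y|)); last by rewrite gt_max x1.
  have : `|x| <= Num.max `|x| `|y| by rewrite le_max lexx.
  have : `|y| <= Num.max `|x| `|y| by rewrite le_max lexx orbT.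
  move: (Num.max _ _) => M; rewrite /z !ler_norml; nra.
have q0 := isq_gt0 z1; have E := sqr_isq z1; set q := isq z in q0 E *.
have hx := isq_ge_tangent q0 x1; have hy := isq_ge_tangent q0 y1.
have sz : z ^+ 2 <= s * x ^+ 2 + (1 - s) * y ^+ 2.
  suff : 0 <= s * (1 - s) * (x - y) ^+ 2 by rewrite /z; nra.
  by apply: mulr_ge0 (sqr_ge0 _); apply: mulr_ge0; lra.
have q3 : 0 <= q * q ^+ 2 by apply: mulr_ge0 (sqr_ge0 _); lra.
have : q * (3 - q ^+ 2 * (1 - (s * x ^+ 2 + (1 - s) * y ^+ 2))) / 2 <=
    s * isq x + (1 - s) * isq y.
  have -> : q * (3 - q ^+ 2 * (1 - (s * x ^+ 2 + (1 - s) * y ^+ 2))) / 2 =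
    s * (q * (3 - q ^+ 2 * (1 - x ^+ 2)) / 2) +
    (1 - s) * (q * (3 - q ^+ 2 * (1 - y ^+ 2)) / 2) by field.
  by apply: lerD; apply: ler_wpM2l => //; lra.
apply: le_trans.
have -> : q * (3 - q ^+ 2 * (1 - (s * x ^+ 2 + (1 - s) * y ^+ 2))) / 2 =
  q * (3 - q ^+ 2 * (1 - z ^+ 2)) / 2 +
  q * q ^+ 2 * (s * x ^+ 2 + (1 - s) * y ^+ 2 - z ^+ 2) / 2 by field.
rewrite E; nra.
Qed.

(** Both [x + s * h] and [x - s * h] are convex combinations of [x + h] and [x - h], with weights
    [(1 + s) / 2] and [(1 - s) / 2] exchanged; the two convexity inequalities add up. *)
Lemma isq_spread x h s : 0 <= s <= 1 -> `|x| + `|h| < 1 ->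
  isq (x + s * h) + isq (x - s * h) <= isq (x + h) + isq (x - h).
Proof.
move=> s01 xh.
have h1 : `|x + h| < 1 by apply: le_lt_trans xh; exact: ler_normD.
have h2 : `|x - h| < 1 by apply: le_lt_trans xh; exact: ler_normB.
have -> : x + s * h = (1 + s) / 2 * (x + h) + (1 - (1 + s) / 2) * (x - h) by field.
have -> : x - s * h = (1 - s) / 2 * (x + h) + (1 - (1 - s) / 2) * (x - h) by field.
have t1 : 0 <= (1 + s) / 2 <= 1 by lra.
have t2 : 0 <= (1 - s) / 2 <= 1 by lra.
have := isq_convex t1 h1 h2; have := isq_convex t2 h1 h2; lra.
Qed.

Lemma continuous_isq y : `|y| < 1 -> {for y, continuous isq}.
Proof.
move=> /sqr_lt1 y1; apply: cvgV; first by rewrite gt_eqF// sqrtr_gt0; lra.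
apply: (@continuous_comp _ _ _ (fun y => 1 - y ^+ 2) Num.sqrt); last first.
  exact: sqrt_continuous.
by apply: cvgB; [exact: cvg_cst|exact: exprn_continuous].
Qed.

Lemma affine_lt1 x rho t : `|x| + `|rho| < 1 -> t \in `]-1, 1[ ->
  `|x + rho * t| < 1.
Proof.
rewrite in_itv/= => xr t1; apply: le_lt_trans xr.
apply: (le_trans (ler_normD _ _)); rewrite lerD2l normrM ler_piMr//.
by rewrite ler_norml; lra.
Qed.

Lemma measurable_isq_affine x rho : `|x| + `|rho| < 1 ->
  measurable_fun (`](-1)%R, 1%R[%classic : set R) (fun t : R => (isq (x + rho * t))%:E).
Proof.
move=> xr; apply/measurable_EFinP.
apply: open_continuous_measurable_fun; first exact: interval_open.
move=> t /set_mem t1.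
apply: (@continuous_comp _ _ _ (fun t => x + rho * t) isq); last first.
  exact/continuous_isq/affine_lt1.
apply: cvgD; first exact: cvg_cst.
by apply: cvgM; [exact: cvg_cst|exact: cvg_id].
Qed.

Lemma measurable_isq : measurable_fun (`](-1)%R, 1%R[%classic : set R) (fun t : R => (isq t)%:E).
Proof.
apply/measurable_EFinP.
apply: open_continuous_measurable_fun; first exact: interval_open.
move=> t /set_mem/=; rewrite in_itv/= => t1.
by apply: continuous_isq; rewrite ltr_norml.
Qed.

End InverseSqrt.

(** * The elliptic integral behind the half-period *)

Section PeriodIntegral.
Context {R : realType}.
Local Notation mu := (@lebesgue_measure R).
Implicit Types x rho t : R.

(** An exhaustion by segments on which [isq] is bounded; [n.+2] keeps their half-widths positive. *)
Lemma bigcup_itv_symm :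
  \bigcup_n [set` `[(- (1 - n.+2%:R^-1))%R, (1 - n.+2%:R^-1)%R]] =
  `](-1)%R, 1%R[%classic :> set R.
Proof.
apply/seteqP; split => [t [n _] /=|t /=]; rewrite !in_itv/= => t1.
  have : 0 < n.+2%:R^-1 :> R by rewrite invr_gt0.
  by move: t1; move: (n.+2%:R^-1) => e; lra.
have nt : `|t| < 1 by rewrite ltr_norml.
have [n] := ltr_add_invr nt.
move=> tn; exists n => //=; rewrite in_itv/= -ler_norml.
have : n.+2%:R^-1 <= n.+1%:R^-1 :> R by rewrite lef_pV2 ?posrE// ler_nat.
by move: tn; move: (n.+1%:R^-1) (n.+2%:R^-1) => e e'; lra.
Qed.

Lemma integral_isq_segment b : 0 < b < 1 ->
  (\int[mu]_(t in `[(- b)%R, b]) (isq t)%:E = (2 * asin b)%:E)%E.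
Proof.
move=> b01.
have dasin t : -1 < t < 1 -> is_derive t 1 asin (isq t) by exact: is_derive1_asin.
have casin t : -1 < t < 1 -> {for t, continuous (@asin R)}.
  exact: continuous_asin.
have asinN : asin (- b) = - asin b.
  have b1 : - 1 <= b <= 1 by lra.
  rewrite -[in LHS](asinK (_ : b \in `[-1, 1])) ?in_itv//= -sinN sinK//.
  by rewrite in_itv/= lerN2 asin_lepi2//= lerNl asin_geNpi2.
rewrite (@continuous_FTC2 _ _ asin).
- by rewrite asinN -EFinB opprK mulr2n mulrDl mul1r.
- lra.
- apply: continuous_in_subspaceT => t /set_mem/=; rewrite in_itv/= => tb.
  by apply: continuous_isq; rewrite ltr_norml; lra.
- split.
  + by move=> t; rewrite in_itv/= => tb; have /dasin[] : -1 < t < 1 by lra.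
  + by apply: cvg_at_right_filter; apply: casin; lra.
  + by apply: cvg_at_left_filter; apply: casin; lra.
- move=> t; rewrite in_itv/= => tb.
  by have /dasin[_ <-] : -1 < t < 1; [lra|rewrite derive1E].
Qed.

(** On each exhausting segment the integral is [2 * asin b], hence at most [pi], and the bound
    survives the monotone limit. *)
Lemma integral_isq_lty : (\int[mu]_(t in `](-1)%R, 1%R[) (isq t)%:E < +oo)%E.
Proof.
rewrite -bigcup_itv_symm.
apply: (@le_lt_trans _ _ pi%:E); last exact: ltry.
have n2 n : 0 < (n.+2%:R^-1 : R) < 1 by rewrite invr_gt0 ltr0n invf_lt1 ?ltr1n.
have sub n : [set` `[(- (1 - n.+2%:R^-1))%R, (1 - n.+2%:R^-1)%R]] `<=`
    (`](-1)%R, 1%R[%classic : set R).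
  by rewrite -bigcup_itv_symm => t tn; exists n.
have := @ge0_nondecreasing_set_cvg_integral _ (measurableTypeR R) R
  (fun n => [set` `[(- (1 - n.+2%:R^-1))%R, (1 - n.+2%:R^-1)%R]] : set R)
  (fun t => (isq t)%:E) mu.
move=> /(_ _ _ _ _)/cvge_to_le; apply.
- move=> m n mn; apply/subsetPset => t /=; rewrite !in_itv/=.
  have : n.+2%:R^-1 <= m.+2%:R^-1 :> R by rewrite lef_pV2 ?posrE// ler_nat.
  by move: (n.+2%:R^-1) (m.+2%:R^-1) => e e'; lra.
- by move=> n; exact: measurable_itv.
- by move=> n; apply: measurable_funS (sub n) measurable_isq.
- by move=> n t _; rewrite lee_fin isq_ge0.
near=> n; rewrite integral_isq_segment.
  have b1 : -1 <= (1 - n.+2%:R^-1 : R) <= 1.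
    by have := n2 n; move: (n.+2%:R^-1) => e; lra.
  by rewrite lee_fin; have := asin_lepi2 b1; lra.
by have := n2 n; move: (n.+2%:R^-1) => e; lra.
Unshelve. all: by end_near.
Qed.

(** For [x = 0] this is twice the complete elliptic integral of the first kind of modulus [rho]. *)
Definition period_integral x rho : \bar R :=
  (\int[mu]_(t in `](-1)%R, 1%R[)
    ((isq (x + rho * t)%R)%:E * (isq t)%:E))%E.

Let measurable_integrand x rho : `|x| + `|rho| < 1 ->
  measurable_fun (`](-1)%R, 1%R[%classic : set R)
    (fun t : R => (isq (x + rho * t)%R)%:E * (isq t)%:E)%E.
Proof.
by move=> xr; apply: emeasurable_funM (measurable_isq_affine xr) measurable_isq.
Qed.

Let integrand_ge0 x rho t : (0 <= (isq (x + rho * t)%R)%:E * (isq t)%:E)%E.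
Proof. by rewrite -EFinM lee_fin mulr_ge0// isq_ge0. Qed.

(** The first factor is at most the constant [isq (|x| + |rho|)], and [isq] itself is integrable. *)
Lemma period_integral_lty x rho : `|x| + `|rho| < 1 ->
  (period_integral x rho < +oo)%E.
Proof.
move=> xr; pose C := isq (`|x| + `|rho|).
apply: (@le_lt_trans _ _ (C%:E * \int[mu]_(t in `](-1)%R, 1%R[) (isq t)%:E)%E).
  rewrite -ge0_integralZl ?lee_fin ?isq_ge0//.
  - apply: ge0_le_integral => //.
    + exact: measurable_integrand.
    + apply: emeasurable_funM; [exact: measurable_cst|exact: measurable_isq].
    + move=> t /=; rewrite in_itv/= => t1.
      rewrite -!EFinM lee_fin ler_wpM2r ?isq_ge0// le_isq//.
      apply: (le_trans (ler_normD _ _)); rewrite lerD2l normrM ler_piMr//.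
      by rewrite ler_norml; lra.
  - exact: measurable_isq.
  - by move=> t _; rewrite lee_fin isq_ge0.
apply: lte_mul_pinfty; rewrite ?lee_fin ?isq_ge0//.
exact: integral_isq_lty.
Qed.

(** Both factors are at least [1] on an interval of length [2]. This later makes [g1] strictly
    positive. *)
Lemma period_integral_ge2 x rho : `|x| + `|rho| < 1 ->
  (2%:E <= period_integral x rho)%E.
Proof.
move=> xr.
have -> : 2%:E = (\int[mu]_(t in `](-1)%R, 1%R[) cst 1%:E t)%E.
  rewrite integral_cst//= lebesgue_measure_itv/= lte_fin ifT; last lra.
  by rewrite mul1e; congr EFin; ring.
apply: ge0_le_integral => //; first exact: measurable_integrand.
move=> t t1; rewrite -EFinM lee_fin/= -[1]mulr1 ler_pM// isq_ge1//.
  exact: affine_lt1.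
by move: t1; rewrite /= in_itv/= ltr_norml.
Qed.

Lemma period_integral_fin x rho : `|x| + `|rho| < 1 ->
  period_integral x rho \is a fin_num.
Proof.
move=> xr; rewrite ge0_fin_numE ?period_integral_lty//.
by apply: le_trans (period_integral_ge2 xr); rewrite lee_fin.
Qed.

Lemma period_integralN x rho : `|x| + `|rho| < 1 ->
  period_integral x (- rho) = period_integral x rho.
Proof.
move=> xr; rewrite /period_integral [RHS]ge0_integral_oppr//.
  by apply: eq_integral => t _; rewrite isqN mulrN mulNr.
exact: measurable_integrand.
Qed.

(* Averaging over [t] and [- t] turns the integrand into
   [(isq (x + rho t) + isq (x - rho t)) / 2 * isq t], which grows with [rho] by
   convexity of [isq]. *)
Lemma le_period_integral x rho s : 0 <= s <= 1 -> `|x| + `|rho| < 1 ->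
  (period_integral x (s * rho)%R <= period_integral x rho)%E.
Proof.
move=> s01 xr.
have xsr : `|x| + `|s * rho| < 1.
  apply: le_lt_trans xr; rewrite lerD2l normrM ler_piMl// ger0_norm//; lra.
suff : (period_integral x (s * rho)%R + period_integral x (- (s * rho))%R <=
        period_integral x rho + period_integral x (- rho)%R)%E.
  rewrite !period_integralN//.
  rewrite -(fineK (period_integral_fin xr)) -(fineK (period_integral_fin xsr)).
  by rewrite -!EFinD !lee_fin; lra.
rewrite /period_integral -!ge0_integralD//; try by apply: measurable_integrand; rewrite ?normrN.
apply: ge0_le_integral => //.
- by move=> t _; apply: adde_ge0.
- by apply: emeasurable_funD; apply: measurable_integrand; rewrite ?normrN.
- by apply: emeasurable_funD; apply: measurable_integrand; rewrite ?normrN.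
move=> t /=; rewrite in_itv/= => t1.
rewrite -!EFinM -!EFinD lee_fin -!mulrDl ler_wpM2r ?isq_ge0//.
rewrite !mulNr -!mulrA; apply: isq_spread => //.
apply: le_lt_trans xr; rewrite lerD2l normrM ler_piMr//.
by rewrite ler_norml; lra.
Qed.

End PeriodIntegral.

(** * The half-period in terms of the roots *)

Section HalfPeriod.
Context {R : realType}.
Implicit Types (m r d u : R) (c : R * R).

(* The [c] for which [Pc c] has the roots [- m - d], [m - r], [m + r], [- m + d],
   whose sum is zero; [Pc] has the right coefficient of [u ^ 2] only if
   [2 m^2 + r^2 + d^2 = 2]. *)
Definition root_coef m r d : R * R :=
  (m * (d ^+ 2 - r ^+ 2) / 2, ((m ^+ 2 - r ^+ 2) * (m ^+ 2 - d ^+ 2) - 1) / 4).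

(** The first condition gives the inner roots opposite signs, the second places the outer roots
    strictly outside them. *)
Definition root_cond m r d := [&& `|m| < r, r + 2 * `|m| < d &
  2 * m ^+ 2 + r ^+ 2 + d ^+ 2 == 2].

Lemma Pc_root_coef m r d u : 2 * m ^+ 2 + r ^+ 2 + d ^+ 2 = 2 ->
  Pc (root_coef m r d) u = ((u + m) ^+ 2 - d ^+ 2) * ((u - m) ^+ 2 - r ^+ 2) / 2.
Proof.
move=> E; rewrite /Pc /W /root_coef /=.
have -> : d ^+ 2 = 2 - 2 * m ^+ 2 - r ^+ 2 by lra.
by field.
Qed.

Lemma Pc_root_coef_eq0 m r d u : 2 * m ^+ 2 + r ^+ 2 + d ^+ 2 = 2 ->
  Pc (root_coef m r d) u = 0 ->
  [\/ u = - m - d, u = m - r, u = m + r | u = - m + d].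
Proof.
move=> E; rewrite Pc_root_coef// => /eqP.
rewrite !mulf_eq0 invr_eq0 pnatr_eq0 orbF !subr_sqr !mulf_eq0.
case/orP => /orP[] /eqP H; [apply: Or44|apply: Or41|apply: Or43|apply: Or42]; lra.
Qed.

Lemma um_root_coef m r d : root_cond m r d -> um (root_coef m r d) = m - r.
Proof.
case/and3P => mr rd /eqP E; rewrite /um.
have mm := ler_norm m; have mN : - m <= `|m| by rewrite -normrN ler_norm.
have ub : ubound [set u : R | u < 0 /\ Pc (root_coef m r d) u = 0] (m - r).
  by move=> u [u0 /(Pc_root_coef_eq0 E)[]] ?; lra.
have in_ : [set u : R | u < 0 /\ Pc (root_coef m r d) u = 0] (m - r).
  by split; [lra|rewrite Pc_root_coef//; field].
apply/eqP; rewrite eq_le; apply/andP; split.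
  by apply: ge_sup => //; exists (m - r).
by apply: ub_le_sup => //; exists (m - r).
Qed.

Lemma uM_root_coef m r d : root_cond m r d -> uM (root_coef m r d) = m + r.
Proof.
case/and3P => mr rd /eqP E; rewrite /uM.
have mm := ler_norm m; have mN : - m <= `|m| by rewrite -normrN ler_norm.
have lb : lbound [set u : R | 0 < u /\ Pc (root_coef m r d) u = 0] (m + r).
  by move=> u [u0 /(Pc_root_coef_eq0 E)[]] ?; lra.
have in_ : [set u : R | 0 < u /\ Pc (root_coef m r d) u = 0] (m + r).
  by split; [lra|rewrite Pc_root_coef//; field].
apply/eqP; rewrite eq_le; apply/andP; split.
  by apply: ge_inf => //; exists (m + r).
by apply: lb_le_inf => //; exists (m + r).
Qed.

Lemma Pc_root_coef_gt0 m r d u : root_cond m r d -> m - r < u < m + r ->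
  0 < Pc (root_coef m r d) u.
Proof.
case/and3P => mr rd /eqP E ur.
have mm := ler_norm m; have mN : - m <= `|m| by rewrite -normrN ler_norm.
rewrite Pc_root_coef//.
have -> : ((u + m) ^+ 2 - d ^+ 2) * ((u - m) ^+ 2 - r ^+ 2) / 2 =
  ((d + (u + m)) * (d - (u + m))) * ((r + (u - m)) * (r - (u - m))) / 2 by field.
by rewrite divr_gt0// !mulr_gt0//; lra.
Qed.

Lemma continuous_Pc c : continuous (Pc c).
Proof.
move=> u; have : is_derive u 1 (Pc c) (2 * (u ^+ 3 - u + c.1)).
  by rewrite /Pc /W; apply: is_derive_eq; rewrite /GRing.scale/=; field.
by case=> /derivable1_diffP/differentiable_continuous.
Qed.

Lemma g1_root_coef m r d : root_cond m r d ->
  g1 (root_coef m r d) =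
  Num.sqrt 2 / d * fine (period_integral (2 * (m / d)) (r / d)).
Proof.
move=> mrd; have /and3P[mr rd /eqP E] := mrd.
have m0 := normr_ge0 m.
have mm := ler_norm m; have mN : - m <= `|m| by rewrite -normrN ler_norm.
(* This is [r + 2 |m| < d] divided by [d]. *)
have xr : `|2 * (m / d)| + `|r / d| < 1.
  rewrite !normrM normfV (ger0_norm (_ : 0 <= d)); last lra.
  rewrite (ger0_norm (_ : 0 <= r)); last lra.
  by rewrite mulrA -mulrDl ltr_pdivrMr ?mul1r ?(ger0_norm (_ : 0 <= 2)); lra.
rewrite /g1 /Rintegral um_root_coef// uM_root_coef//.
have -> : m - r = m + r * (- 1) by ring.
have -> : `]m + r * -1, m + r[ = `]m + r * - 1, m + r * 1[ by rewrite mulr1.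
rewrite ge0_integral_affine; first last.
- by move=> u _; rewrite lee_fin invr_ge0 sqrtr_ge0.
- apply/measurable_EFinP.
  apply: open_continuous_measurable_fun; first exact: interval_open.
  move=> u /set_mem/=; rewrite in_itv/= => ur.
  apply: cvgV; first by rewrite gt_eqF// sqrtr_gt0 Pc_root_coef_gt0//; lra.
  apply: (@continuous_comp _ _ _ (Pc _) Num.sqrt); first exact: continuous_Pc.
  exact: sqrt_continuous.
- lra.
(* The factor [r] is the Jacobian; the rest comes out of the integrand. *)
have -> : Num.sqrt 2 / d = r * (Num.sqrt 2 / (d * r)) by field; rewrite !gt_eqF//; lra.
rewrite -mulrA -[X in X * _]/(fine r%:E) -[X in _ * (X * _)]/(fine (Num.sqrt 2 / (d * r))%:E).
rewrite -!fineM ?period_integral_fin//; last first.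
  by rewrite fin_numM// period_integral_fin.
congr (fine (_ * _)%E); rewrite /period_integral -ge0_integralZl//=; first last.
- by rewrite lee_fin divr_ge0 ?sqrtr_ge0// mulr_ge0; lra.
- by move=> t _; rewrite -EFinM lee_fin mulr_ge0// isq_ge0.
- by apply: emeasurable_funM (measurable_isq_affine xr) measurable_isq.
apply: eq_integral => t /set_mem/=; rewrite in_itv/= => t1.
rewrite -!EFinM; congr EFin.
rewrite Pc_root_coef//.
(* Since [2 m + r t = d y], the quadratic factors become [d ^ 2 (y ^ 2 - 1)] and
   [r ^ 2 (t ^ 2 - 1)]. *)
pose y := 2 * (m / d) + r / d * t.
have -> : ((m + r * t + m) ^+ 2 - d ^+ 2) * ((m + r * t - m) ^+ 2 - r ^+ 2) / 2 =
    ((d * r) ^+ 2 / 2) * ((1 - y ^+ 2) * (1 - t ^+ 2)).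
  by rewrite /y; field; lra.
rewrite sqrtrM; last by rewrite divr_ge0// sqr_ge0.
rewrite [Num.sqrt ((1 - y ^+ 2) * _)]sqrtrM; last first.
  by rewrite subr_ge0 ltW// sqr_lt1// affine_lt1// in_itv.
rewrite sqrtrM ?sqr_ge0// sqrtr_sqr sqrtrV// ger0_norm; last by rewrite mulr_ge0; lra.
by rewrite !invfM invrK /isq -/y; ring.
Qed.

End HalfPeriod.

(** * Absence of critical points of the half-period *)

Section CriticalValues.
Context {R : realType}.
Implicit Types (m r d k : R) (c : R * R).

(** Take [m] and [r] as midpoint and half-width of the inner pair of roots, [d] as half-width of the
    outer pair. The outer midpoint is [- m] because the roots sum to zero. *)
Lemma Cset_root_coef c : Cset c ->
  exists m r d, root_cond m r d /\ c = root_coef m r d.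
Proof.
case: c => c1 c2 [_ [x1 [x2 [x3 [x4 [x12 x34 [p1 p2] [p3 p4]]]]]]].
have {}p1 : (x1 ^+ 2 - 1) ^+ 2 / 4 + c1 * x1 + c2 = 0 by move: p1; rewrite /Pc /W/=; lra.
have {}p2 : (x2 ^+ 2 - 1) ^+ 2 / 4 + c1 * x2 + c2 = 0 by move: p2; rewrite /Pc /W/=; lra.
have {}p3 : (x3 ^+ 2 - 1) ^+ 2 / 4 + c1 * x3 + c2 = 0 by move: p3; rewrite /Pc /W/=; lra.
have {}p4 : (x4 ^+ 2 - 1) ^+ 2 / 4 + c1 * x4 + c2 = 0 by move: p4; rewrite /Pc /W/=; lra.
have dd (x y : R) (p q : R) : y < x -> (x - y) * p = 0 -> p = 0.
  by move=> yx /eqP; rewrite mulf_eq0 subr_eq0 gt_eqF//= => /eqP.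
(* Newton's divided differences of the quartic at its roots vanish. *)
pose D2 (x y : R) := x ^+ 3 + x ^+ 2 * y + x * y ^+ 2 + y ^+ 3 - 2 * (x + y) + 4 * c1.
have e21 : D2 x2 x1 = 0.
  by apply: (dd x2 x1) => //; [lra|rewrite /D2; lra].
have e31 : D2 x3 x1 = 0.
  by apply: (dd x3 x1) => //; [lra|rewrite /D2; lra].
have e41 : D2 x4 x1 = 0.
  by apply: (dd x4 x1) => //; [lra|rewrite /D2; lra].
pose D3 (x y z : R) := x ^+ 2 + y ^+ 2 + z ^+ 2 + x * y + y * z + x * z - 2.
have e321 : D3 x3 x2 x1 = 0.
  by apply: (dd x3 x2) => //; [lra|move: e21 e31; rewrite /D2 /D3; lra].
have e421 : D3 x4 x2 x1 = 0.
  by apply: (dd x4 x2) => //; [lra|move: e21 e41; rewrite /D2 /D3; lra].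
have s0 : x1 + x2 + x3 + x4 = 0.
  by apply: (dd x4 x3) => //; [lra|move: e321 e421; rewrite /D3; lra].
have E4 : x4 = - x1 - x2 - x3 by lra.
exists ((x2 + x3) / 2), ((x3 - x2) / 2), ((x4 - x1) / 2).
split.
  apply/and3P; split.
  - by rewrite ltr_norml; lra.
  - suff : `|(x2 + x3) / 2| < ((x4 - x1) / 2 - (x3 - x2) / 2) / 2 by lra.
    by rewrite ltr_norml; lra.
  - by apply/eqP; move: e321; rewrite /D3 E4; lra.
(* Eliminating [x1 ^ 2 + x2 ^ 2 - 2] between [D2] and [D3] leaves [c1] in terms of the roots. *)
have c1E : c1 = (x1 + x2) * (x1 + x3) * (x2 + x3) / 4.
  by have : (x1 + x2) * D3 x3 x2 x1 = 0; [rewrite e321 mulr0|move: e21; rewrite /D2 /D3; lra].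
rewrite /root_coef E4; congr pair; first by rewrite c1E; field.
have : x1 ^+ 2 * D3 x3 x2 x1 = 0 by rewrite e321 mulr0.
by move: p1; rewrite /D3 c1E; lra.
Qed.

(** Left difference quotients have a negative denominator and a nonnegative numerator near [x]. *)
Lemma is_derive_left_le0 (f : R -> R) (x a : R) : is_derive x 1 f a ->
  (\forall y \near x^'-, f x <= f y) -> a <= 0.
Proof.
move=> [df <-] /nbhs_left0P fx.
set q := fun h : R => h^-1 *: ((f \o shift x) (h *: 1) - f x).
have dq : q h @[h --> 0^'-] --> 'D_1 f x.
  move=> A /df /nbhs_ballP[_ /posnumP[e] xe_A].
  by exists e%:num => //= y xe_y /lt_eqF/negbT/xe_A; exact.
apply: (cvgr_to_le dq); rewrite -{1}oppr0 at_leftN !near_simpl.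
near=> e; have e0 : 0 < e by [].
rewrite /q /= [_%:A]mulr1 [- e + x]addrC.
rewrite (_ : _ *: _ = (- e)^-1 * (f (x - e) - f x))//.
rewrite mulr_le0_ge0// ?invr_le0 ?oppr_le0 ?(ltW e0)// subr_ge0.
by near: e.
Unshelve. all: by end_near. Qed.

(* Along the curve [m = k * d] the product [d * g1] is, by [g1_root_coef], a
   period integral which grows as [d] decreases; were the differential zero, its
   derivative would be [g1 c > 0]. *)
Lemma g1_regular c : Cset c -> differentiable (@g1 R) c ->
  ~ (forall v, 'd (@g1 R) c v = 0).
Proof.
move=> /Cset_root_coef[m [r [d [mrd ->]]]] dg g0.
have /and3P[mr rd /eqP E] := mrd.
have m0 := normr_ge0 m.
have d0 : 0 < d by lra.
pose k := m / d.
have mE : m = k * d by rewrite /k; field; lra.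
(* The value of [r ^ 2] that [root_cond] forces when [m = k * x] and [d = x]. *)
pose rr x := 2 - 2 * (k * x) ^+ 2 - x ^+ 2.
have rrd : rr d = r ^+ 2 by rewrite /rr -mE; lra.
have sqrtd : Num.sqrt (rr d) = r by rewrite rrd sqrtr_sqr ger0_norm//; lra.
(* This is [root_coef (k * x) (Num.sqrt (rr x)) x] with the square root squared away, so it is
   polynomial in [x]. *)
pose gam x : R * R := (k * x * (x ^+ 2 - rr x) / 2,
    (((k * x) ^+ 2 - rr x) * ((k * x) ^+ 2 - x ^+ 2) - 1) / 4).
pose F x := x * g1 (gam x).
pose K x := fine (period_integral (2 * k) (Num.sqrt (rr x) / x)).
have FE x : 0 < x -> 0 <= rr x -> root_cond (k * x) (Num.sqrt (rr x)) x ->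
    F x = Num.sqrt 2 * K x.
  move=> x0 rx cx; have xn : x != 0 by rewrite gt_eqF.
  have -> : F x = x * g1 (root_coef (k * x) (Num.sqrt (rr x)) x).
    by rewrite /F /root_coef sqr_sqrtr.
  by rewrite g1_root_coef// mulfK// /K; field.
have k1 : 2 * `|k| + r / d < 1.
  rewrite /k normrM normfV (ger0_norm (ltW d0)) mulrA -mulrDl.
  by rewrite ltr_pdivrMr// mul1r; lra.
have rd0 : 0 <= r / d by rewrite divr_ge0//; lra.
have kr : `|2 * k| + `|r / d| < 1.
  by rewrite normrM (ger0_norm (_ : 0 <= 2))// (ger0_norm rd0).
have Fd0 : 0 < F d.
  rewrite FE// ?sqrtd -?mE// ?rrd ?sqr_ge0// mulr_gt0 ?sqrtr_gt0//.
  rewrite /K sqrtd fine_gt0//; apply/andP; split; last exact: period_integral_lty.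
  by apply: lt_le_trans (period_integral_ge2 kr); rewrite lte_fin.
have near_ge : \forall x \near d^'-, F d <= F x.
  pose A := 2 * k ^+ 2 + 1.
  (* The square of [r < (1 - 2 |k|) d], using [r ^ 2 = 2 - A d ^ 2]. In this form the condition
     visibly persists near [d]. *)
  have Ad : 2 < d ^+ 2 * (A + (1 - 2 * `|k|) ^+ 2).
    have : r < (1 - 2 * `|k|) * d by rewrite -ltr_pdivrMr//; lra.
    by move: rrd; rewrite /rr /A; nra.
  have nd : \forall x \near d, 0 < x /\ 2 < x ^+ 2 * (A + (1 - 2 * `|k|) ^+ 2).
    apply: filterI; first exact: lt_nbhsr.
    have : (fun x => x ^+ 2 * (A + (1 - 2 * `|k|) ^+ 2)) x @[x --> d] -->
        d ^+ 2 * (A + (1 - 2 * `|k|) ^+ 2).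
      by apply: cvgM; [exact: exprn_continuous|exact: cvg_cst].
    by move/cvgr_gt; apply.
  near=> x.
  have xd : x < d by [].
  have [x0 xA] : 0 < x /\ 2 < x ^+ 2 * (A + (1 - 2 * `|k|) ^+ 2).
    by near: x; rewrite near_withinE; apply: filterS nd.
  have rx : rr d <= rr x.
    have xd2 : 0 <= d ^+ 2 - x ^+ 2 by nra.
    by have := mulr_ge0 (sqr_ge0 k) xd2; rewrite /rr; lra.
  have rx0 : 0 < rr x by rewrite (lt_le_trans _ rx)// rrd exprn_gt0//; lra.
  set r' := Num.sqrt (rr x).
  have r'0 : 0 < r' by rewrite sqrtr_gt0.
  have r'E : r' ^+ 2 = rr x by rewrite sqr_sqrtr// ltW.
  have rr' : r <= r' by rewrite -sqrtd ler_wsqrtr.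
  have k0 := normr_ge0 k.
  have xk : r' < (1 - 2 * `|k|) * x.
    rewrite -(@ltr_pXn2r _ 2) ?nnegrE//; last 2 first.
    - exact: ltW.
    - by rewrite mulr_ge0//; lra.
    by rewrite r'E; move: xA; rewrite /rr /A; nra.
  have cx : root_cond (k * x) r' x.
    apply/and3P; split; rewrite ?(normrM k x) ?(gtr0_norm x0)//.
    - have : `|m| = `|k| * d by rewrite mE (normrM k d) (gtr0_norm d0).
      by have := ler_wpM2l k0 (ltW xd); lra.
    - lra.
    - by rewrite r'E /rr; apply/eqP; ring.
  have k2 : `|2 * k| + `|r' / x| < 1.
    rewrite normrM (ger0_norm (_ : 0 <= 2))// (ger0_norm (_ : 0 <= r' / x)).
      by rewrite -ltrBrDl ltr_pdivrMr.
    by rewrite divr_ge0// ltW.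
  rewrite !FE ?(ltW rx0)//; last 2 first.
  - by rewrite rrd sqr_ge0.
  - by rewrite sqrtd -mE.
  rewrite ler_wpM2l ?sqrtr_ge0// /K fine_le ?sqrtd ?period_integral_fin//.
  (* As [d] shrinks to [x], [r] grows to [r'], so the bracketed factor lies in [[0, 1]]. *)
  have -> : r / d = (r * x / (r' * d)) * (r' / x) by field; rewrite !gt_eqF.
  apply: le_period_integral => //; apply/andP; split.
    by rewrite divr_ge0// mulr_ge0//; lra.
  by rewrite ler_pdivrMr ?mulr_gt0// mul1r ler_pM//; lra.
have dgam : differentiable gam d.
  by apply: differentiable_pair; apply/derivable1_diffP; rewrite /rr; exact: ex_derive.
have gamd : gam d = root_coef m r d by rewrite /gam /root_coef rrd -mE.
have dF : is_derive d 1 F (g1 (root_coef m r d)).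
  have dgg : differentiable (@g1 R \o gam) d by apply: differentiable_comp; rewrite ?gamd.
  (* The vanishing differential kills this term, so the product rule for [x * g1 (gam x)] leaves
     only [g1]. *)
  have dg1 : is_derive d 1 (@g1 R \o gam) 0.
    apply: DeriveDef; first exact/derivable1_diffP.
    by rewrite deriveE// diff_comp ?gamd//= g0.
  have := is_deriveM (is_derive_id d 1) dg1.
  by rewrite scaler0 add0r /= gamd scaler1.
suff : g1 (root_coef m r d) <= 0.
  by apply/negP; rewrite -ltNge -gamd -(pmulr_rgt0 _ d0).
exact: is_derive_left_le0 dF near_ge.
Unshelve. all: by end_near. Qed.
Lemma critical_values0 : @critical_values R = set0.
Proof. by apply/seteqP; split => // v [c [cC dg g0] _]; case: (g1_regular cC dg g0). Qed.

End CriticalValues.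

(** * Newton's equation and uniqueness by Gronwall's inequality *)

Section Energy.
Context {R : realType}.
Implicit Types (u v w z e : R -> R) (x y t K : R) (c : R * R).

Lemma is_derive_unique (f : R -> R) x (a b : R) :
  is_derive x 1 f a -> is_derive x 1 f b -> a = b.
Proof. by move=> [_ <-] [_ <-]. Qed.

Lemma is_derive_continuous (f : R -> R) x (a : R) :
  is_derive x 1 f a -> {for x, continuous f}.
Proof. by case=> /derivable1_diffP/differentiable_continuous. Qed.

Lemma is_derive_compD (f : R -> R) s x (a : R) :
  is_derive (x + s) 1 f a -> is_derive x 1 (fun y => f (y + s)) a.
Proof.
move=> fa; have := @is_derive1_comp _ f (fun y => y + s) x a 1 fa _.
by rewrite mulr1; apply; apply: is_derive_eq; rewrite addr0.
Qed.

(* With [phi = w - (u^3 - u + c.1)] the energy identity gives [v phi = 0].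
   Differentiating twice, [w phi = 0] and [phi phi' = 0], so [phi ^ 2] is
   constant; were it nonzero, [v] would vanish identically. *)
Lemma newton_of_energy c u v w z :
  (forall x, is_derive x 1 u (v x)) -> (forall x, is_derive x 1 v (w x)) ->
  (forall x, is_derive x 1 w (z x)) -> nonconstant u ->
  (forall x, 2^-1 * v x ^+ 2 = W (u x) + c.1 * u x + c.2) ->
  forall x, w x = u x ^+ 3 - u x + c.1.
Proof.
move=> du dv dw nu E.
pose phi x := w x - (u x ^+ 3 - u x + c.1).
have dphi x : is_derive x 1 phi (z x - (3 * u x ^+ 2 - 1) * v x).
  by rewrite /phi; apply: is_derive_eq; rewrite /GRing.scale/=; ring.
have vphi x : v x * phi x = 0.
  have d1 : is_derive x 1 (fun x => 2^-1 * v x ^+ 2) (v x * w x).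
    by apply: is_derive_eq; rewrite /GRing.scale/=; field.
  have d2 : is_derive x 1 (fun x => 2^-1 * v x ^+ 2) (v x * (u x ^+ 3 - u x + c.1)).
    rewrite (funext E) /W.
    by apply: is_derive_eq; rewrite /GRing.scale/=; field.
  by rewrite /phi mulrBr (is_derive_unique d1 d2) subrr.
have zero (f : R -> R) x a : (forall y, f y = 0) -> is_derive x 1 f a -> a = 0.
  move=> f0 /is_derive_unique; apply.
  by rewrite (_ : f = cst 0); [exact: is_derive_cst|apply/funext].
have wphi x : w x * phi x = 0.
  have [->|phi0] := eqVneq (phi x) 0; first exact: mulr0.
  have v0 : v x = 0 by apply: (mulIf phi0); rewrite vphi mul0r.
  apply: (zero _ x _ vphi); apply: is_derive_eq.
  by rewrite /GRing.scale/= v0; ring.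
have phidphi x : phi x * (z x - (3 * u x ^+ 2 - 1) * v x) = 0.
  have [->|phi0] := eqVneq (phi x) 0; first exact: mul0r.
  have v0 : v x = 0 by apply: (mulIf phi0); rewrite vphi mul0r.
  have w0 : w x = 0 by apply: (mulIf phi0); rewrite wphi mul0r.
  apply: (zero _ x _ wphi); apply: is_derive_eq.
  by rewrite /GRing.scale/= v0 w0; ring.
have sphi x y : phi x ^+ 2 = phi y ^+ 2.
  apply: (is_derive_0_is_cst (f := fun x => phi x ^+ 2)) => t.
  apply: is_derive_eq; rewrite -[RHS](mulr0 2) -(phidphi t).
  by rewrite /GRing.scale/=; ring.
move=> x; apply/eqP; rewrite -subr_eq0 -/(phi x) -sqrf_eq0; apply: contrapT => phix.
apply: nu; exists (u 0) => y; apply: is_derive_0_is_cst => t.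
suff <- : v t = 0 by [].
apply: (@mulIf _ (phi t)); last by rewrite vphi mul0r.
by apply/negP => /eqP phit; apply: phix; rewrite (sphi x t) phit expr0n.
Qed.

(** The product [e y * expR (- K * y)] is nonincreasing and starts at [0]. *)
Lemma gronwall_right e (e' : R -> R) K :
  (forall x, is_derive x 1 e (e' x)) -> (forall x, 0 <= e x) ->
  (forall x, e' x <= K * e x) -> e 0 = 0 ->
  forall x, 0 <= x -> e x = 0.
Proof.
move=> de e0 eK e00 x x0.
pose g y := e y * expR (- K * y).
have dg y : is_derive y 1 g ((e' y - K * e y) * expR (- K * y)).
  by apply: is_derive_eq; rewrite /GRing.scale/=; ring.
have : g x <= g 0.
  apply: (@ler0_derive1_nincry _ g 0) => //.
  - move=> y _; rewrite derive1E; have [_ ->] := dg y.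
    by rewrite mulr_le0_ge0 ?expR_ge0// subr_le0.
  - by apply: continuous_subspaceT => y; exact: is_derive_continuous (dg y).
rewrite /g e00 mul0r pmulr_lle0 ?expR_gt0// => ex.
by apply/eqP; rewrite eq_le ex e0.
Qed.

Lemma gronwall_zero e (e' : R -> R) K :
  (forall x, is_derive x 1 e (e' x)) -> (forall x, 0 <= e x) ->
  (forall x, `|e' x| <= K * e x) -> e 0 = 0 -> forall x, e x = 0.
Proof.
move=> de e0 eK e00 x; have [x0|/ltW x0] := leP 0 x.
  apply: (gronwall_right de e0 (K := K)) x0 => // y.
  exact: le_trans (ler_norm _) (eK y).
rewrite -[x]opprK.
apply: (@gronwall_right (fun y => e (- y)) (fun y => - e' (- y)) K); rewrite ?oppr0 ?oppr_ge0//.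
- move=> y; have := @is_derive1_comp _ e -%R y (e' (- y)) (-1) (de _) _.
  by rewrite mulrN1; apply; apply: is_derive_eq.
- by move=> y; apply: le_trans (eK (- y)); rewrite -normrN ler_norm.
Qed.

(** The first-order equation loses uniqueness at turning points, the second-order one does not.
    Gronwall applies to [e]: as [u ^ 3 - v ^ 3 = (u - v) q], the linear terms cancel in its
    derivative, and [|q| <= 3 B ^ 2]. *)
Lemma newton_unique c u v u' v' (B : R) :
  (forall x, is_derive x 1 u (u' x)) -> (forall x, is_derive x 1 v (v' x)) ->
  (forall x, is_derive x 1 u' (u x ^+ 3 - u x + c.1)) ->
  (forall x, is_derive x 1 v' (v x ^+ 3 - v x + c.1)) ->
  (forall x, `|u x| <= B) -> (forall x, `|v x| <= B) ->
  u 0 = v 0 -> u' 0 = v' 0 -> u = v.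
Proof.
move=> du dv du' dv' uB vB uv0 uv0'.
pose e x := (u x - v x) ^+ 2 + (u' x - v' x) ^+ 2.
pose q x := u x ^+ 2 + u x * v x + v x ^+ 2.
have de x : is_derive x 1 e (2 * ((u x - v x) * (u' x - v' x)) * q x).
  by apply: is_derive_eq; rewrite /q /GRing.scale/=; ring.
have B0 : 0 <= B by exact: le_trans (normr_ge0 _) (uB 0).
have e0 x : 0 <= e x by rewrite addr_ge0// sqr_ge0.
have eK x : `|2 * ((u x - v x) * (u' x - v' x)) * q x| <= 3 * B ^+ 2 * e x.
  rewrite mulrC normrM; apply: ler_pM => //.
    rewrite ler_norml /q; move: (uB x) (vB x); rewrite !ler_norml.
    by move=> /andP[? ?] /andP[? ?]; apply/andP; split; nra.
  rewrite ler_norml /e; move: (u x - v x) (u' x - v' x) => a b.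
  by have := sqr_ge0 (a + b); have := sqr_ge0 (a - b); lra.
have ez : e 0 = 0 by rewrite /e uv0 uv0' !subrr expr0n addr0.
apply/funext => x; have := gronwall_zero de e0 eK ez x.
move/eqP; rewrite paddr_eq0 ?sqr_ge0// => /andP[/eqP + _].
by move/eqP; rewrite sqrf_eq0 subr_eq0 => /eqP.
Qed.

End Energy.

(** * Range of a periodic solution *)

Section PeriodicSolutions.
Context {R : realType}.
Implicit Types (u v : R -> R) (x y t L T : R) (c : R * R).

Lemma solution_is_derive c u : solution c u ->
  forall x, is_derive x 1 u (derive1 u x).
Proof.
by move=> [su _ _] x; apply: DeriveDef; [exact: su 0%N x|rewrite derive1E].
Qed.

Lemma solution_newton c u : solution c u ->
  forall x, is_derive x 1 (derive1 u) (u x ^+ 3 - u x + c.1).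
Proof.
move=> cu; have [su nu E] := cu.
have d n x : is_derive x 1 (derive1n n u) (derive1n n.+1 u x).
  by apply: DeriveDef; [exact: su|rewrite derive1nS derive1E].
move=> x; rewrite -(newton_of_energy (d 0%N) (d 1%N) (d 2%N) nu E).
exact: d 1%N x.
Qed.

Lemma solution_Pc c u : solution c u -> forall x, Pc c (u x) = derive1 u x ^+ 2.
Proof. by move=> [_ _ E] x; rewrite /Pc -E; field. Qed.

Lemma solution_continuous c u : solution c u -> continuous u.
Proof. by move=> cu x; exact: is_derive_continuous (solution_is_derive cu x). Qed.

Lemma periodic_int u T (n : int) x : periodic u T -> u (x + n%:~R * T) = u x.
Proof.
move=> uT; case: n => n.
  by rewrite -pmulrn mulr_natl (periodicn uT).
by rewrite NegzE mulrNz mulNr -pmulrn mulr_natl -[in RHS](subrK (T *+ n.+1) x) (periodicn uT).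
Qed.

Lemma periodic_modulo T x : 0 < T -> exists n : int, 0 <= x - n%:~R * T < T.
Proof.
move=> T0; exists (Num.floor (x / T)).
have /andP[h1 h2] := floor_itv (x / T).
move: h1 h2; rewrite ler_pdivlMr// ltr_pdivrMr// intrD mulrDl mul1r; lra.
Qed.

Lemma periodic_reduce u T x : has_period u T ->
  exists2 y, 0 <= y < T & u y = u x.
Proof.
move=> [T0 uT]; have [n nT] := periodic_modulo x T0.
exists (x - n%:~R * T) => //; by rewrite -mulNr -mulrNz periodic_int.
Qed.

Lemma solution_max c u L : solution c u -> has_period u L ->
  exists2 x, derive1 u x = 0 & forall y, u y <= u x.
Proof.
move=> cu uL; have [L0 _] := uL.
have [x _ xmax] : exists2 x, x \in `[0, L] & forall t, t \in `[0, L] -> u t <= u x.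
  apply: EVT_max; first exact: ltW.
  by apply: continuous_subspaceT; exact: solution_continuous cu.
have {}xmax y : u y <= u x.
  have [z zL <-] := periodic_reduce y uL.
  by apply: xmax; rewrite in_itv/=; lra.
exists x => //; apply: is_derive_unique (solution_is_derive cu x) _.
(* The maximum is global, so it is interior to []x - 1, x + 1[] even if [x] is an endpoint of
   [[0, L]]. *)
apply: (@derive1_at_max _ u (x - 1) (x + 1)) => //.
- lra.
- by move=> t _; have [] := solution_is_derive cu t.
- by rewrite in_itv/=; lra.
Qed.

Lemma solution_min c u L : solution c u -> has_period u L ->
  exists2 x, derive1 u x = 0 & forall y, u x <= u y.
Proof.
move=> cu uL; have [L0 _] := uL.
have [x _ xmin] : exists2 x, x \in `[0, L] & forall t, t \in `[0, L] -> u x <= u t.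
  apply: EVT_min; first exact: ltW.
  by apply: continuous_subspaceT; exact: solution_continuous cu.
have {}xmin y : u x <= u y.
  have [z zL <-] := periodic_reduce y uL.
  by apply: xmin; rewrite in_itv/=; lra.
exists x => //; apply: is_derive_unique (solution_is_derive cu x) _.
apply: (@derive1_at_min _ u (x - 1) (x + 1)) => //.
- lra.
- by move=> t _; have [] := solution_is_derive cu t.
- by rewrite in_itv/=; lra.
Qed.

Lemma Pc_root_coef_lt0 (m r d y : R) : root_cond m r d ->
  - m - d < y < m - r \/ m + r < y < - m + d -> Pc (root_coef m r d) y < 0.
Proof.
case/and3P => mr rd /eqP E yr.
have mm := ler_norm m; have mN : - m <= `|m| by rewrite -normrN ler_norm.
rewrite Pc_root_coef// -oppr_gt0.
have -> : - (((y + m) ^+ 2 - d ^+ 2) * ((y - m) ^+ 2 - r ^+ 2) / 2) =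
  ((d + (y + m)) * (d - (y + m))) * ((y - m - r) * (y - m + r)) / 2 by field.
rewrite divr_gt0// pmulr_rgt0; first by case: yr => yr; nra.
by rewrite mulr_gt0; lra.
Qed.

(** The extreme values are roots of [Pc c]. Since [Pc c (u x)] is a square, [u] cannot cross the two
    gaps where [Pc c] is negative, which leaves only the inner roots. *)
Lemma solution_range c u L : Cset c -> solution c u -> has_period u L ->
  (exists2 x, u x = uM c & derive1 u x = 0) /\ forall x, um c <= u x <= uM c.
Proof.
move=> /Cset_root_coef[m [r [d [mrd ->]]]] cu uL.
have /and3P[mr rd /eqP E] := mrd.
have mm := ler_norm m; have mN : - m <= `|m| by rewrite -normrN ler_norm.
have [x x0 xmax] := solution_max cu uL; have [y y0 ymin] := solution_min cu uL.
have uxy : u y < u x.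
  rewrite lt_neqAle ymin andbT; apply/eqP => uxy.
  case: cu => _ nu _; apply: nu; exists (u x) => t.
  by apply/eqP; rewrite eq_le xmax -uxy ymin.
have xr : Pc (root_coef m r d) (u x) = 0 by rewrite (solution_Pc cu) x0 expr0n.
have yr : Pc (root_coef m r d) (u y) = 0 by rewrite (solution_Pc cu) y0 expr0n.
have ivt z : u y < z < u x ->
    ~ (- m - d < z < m - r \/ m + r < z < - m + d).
  move=> yzx /(Pc_root_coef_lt0 mrd).
  suff [t <-] : exists t, u t = z.
    by rewrite (solution_Pc cu) ltNge sqr_ge0.
  have cont a b : {within `[a, b], continuous u}.
    by apply: continuous_subspaceT; exact: solution_continuous cu.
  have /andP[/ltW yz /ltW zx] := yzx.
  have [xy|/ltW yx] := leP x y.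
    have [|t _ <-] := IVT xy (cont _ _) (v := z); last by exists t.
    by rewrite ge_min le_max yz zx orbT.
  have [|t _ <-] := IVT yx (cont _ _) (v := z); last by exists t.
  by rewrite ge_min le_max yz zx orbT.
rewrite um_root_coef// uM_root_coef//.
have r0 : 0 < r by have := normr_ge0 m; lra.
have [uxE uyE] : u x = m + r /\ u y = m - r.
  (* Midpoints of the two gaps: every other pair of distinct roots has one of them in between. *)
  have h1 := ivt ((- m - d + (m - r)) / 2); have h2 := ivt ((m + r + (- m + d)) / 2).
  case: (Pc_root_coef_eq0 E xr) (Pc_root_coef_eq0 E yr) => xE []yE;
    first [by split; lra | exfalso; move: uxy; lra |
      exfalso; apply: h1; [lra|left; lra] | exfalso; apply: h2; [lra|right; lra]].
by split; [exists x|move=> t; rewrite -uyE -uxE ymin xmax].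
Qed.

End PeriodicSolutions.

(** * Translation orbits, principal periods and means *)

Section Orbits.
Context {R : realType}.
Implicit Types (u v : R -> R) (x y t s L T : R) (c : R * R).

(** Both solutions reach [uM c] with zero derivative. Moved to start there, they share their initial
    data and a common bound, so they coincide. *)
Lemma solution_translate c u v L : Cset c ->
  solution c u -> has_period u L -> solution c v -> has_period v L ->
  exists s, forall x, v x = u (x + s).
Proof.
move=> cC cu uL cv vL.
have [[x0 ux0 dux0] ur] := solution_range cC cu uL.
have [[y0 vy0 dvy0] vr] := solution_range cC cv vL.
have bound y : um c <= y <= uM c -> `|y| <= Num.max `|um c| `|uM c|.
  move=> yr; rewrite ler_norml; apply/andP; split.
    rewrite lerNl le_max; apply/orP; left.
    by apply: le_trans (_ : - um c <= _); [lra|rewrite -normrN ler_norm].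
  rewrite le_max; apply/orP; right.
  by apply: le_trans (_ : uM c <= _); [lra|exact: ler_norm].
have uv : (fun x => u (x + x0)) = (fun x => v (x + y0)).
  apply: (@newton_unique _ c _ _ (fun x => derive1 u (x + x0))
    (fun x => derive1 v (x + y0)) (Num.max `|um c| `|uM c|)) => [x|x|x|x|x|x||].
  - exact/is_derive_compD/(solution_is_derive cu).
  - exact/is_derive_compD/(solution_is_derive cv).
  - exact/is_derive_compD/(solution_newton cu).
  - exact/is_derive_compD/(solution_newton cv).
  - exact: bound.
  - exact: bound.
  - by rewrite !add0r ux0 vy0.
  - by rewrite !add0r dux0 dvy0.
exists (x0 - y0) => x.
by have := congr1 (fun f => f (x - y0)) uv; rewrite /= subrK => <-; rewrite addrA addrAC.
Qed.

(** A shifted parameter is brought back into [[0, L[] by a multiple of [L]; the reverse inclusion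
    shifts by [- s]. *)
Lemma translation_orbit_shift u L s : has_period u L ->
  translation_orbit L (fun x => u (x + s)) = translation_orbit L u.
Proof.
move=> uL; have [L0 pu] := uL.
have sub v w a : has_period v L -> (forall x, w x = v (x + a)) ->
    translation_orbit L w `<=` translation_orbit L v.
  move=> [_ pv] wv f [b bL <-].
  have [n nL] := periodic_modulo (b + a) L0.
  exists (b + a - n%:~R * L); first by rewrite /= in_itv.
  apply/funext => x.
  by rewrite wv addrA -mulNr -mulrNz periodic_int// addrA.
apply/seteqP; split; first exact: (@sub _ _ s).
apply: (@sub _ _ (- s)); last by move=> x; rewrite subrK.
by split=> // x; rewrite addrAC pu.
Qed.

(** The infimum of the periods is the candidate: by continuity it satisfies the period identity. *)
Lemma principal_period_exists u L : continuous u -> nonconstant u ->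
  has_period u L -> exists T, principal_period u T.
Proof.
move=> cu nu uL.
pose S := [set t | has_period u t].
have S0 : S !=set0 by exists L.
have Slb : has_lbound S by exists 0 => t [/ltW].
have infS : has_inf S by [].
pose T := inf S.
have T0 : 0 <= T by apply: lb_le_inf => // t [/ltW].
have TS t : S t -> T <= t by move=> St; exact: ge_inf.
have close y e : 0 < e -> exists2 t, S t & `|u (y + t) - u (y + T)| < e.
  move=> e0.
  have : \forall t \near T, `|u (y + t) - u (y + T)| < e.
    have : u (y + t) @[t --> T] --> u (y + T).
      by apply: (continuous_comp (g := u)); [apply: cvgD; [exact: cvg_cst|exact: cvg_id]|exact: cu].
    by move/cvgr_dist_lt => /(_ _ e0); apply: filterS => t; rewrite distrC.
  move=> /nbhs_ballP[d /= d0 Td].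
  have [t St tT] := inf_adherent d0 infS.
  exists t => //; apply: Td; rewrite /ball/= distrC ger0_norm; first by rewrite ltrBlDl.
  by rewrite subr_ge0 TS.
have pT : periodic u T.
  move=> y; apply/eqP; rewrite eq_sym -subr_eq0 -normr_le0; apply/ler_addgt0Pr => e e0.
  by have [t [_ ut] /ltW] := close y e e0; rewrite ut add0r.
exists T; split=> //; split => //; rewrite lt_neqAle T0 andbT.
(* Were the infimum [0], periods would be arbitrarily small, so every value of [u] would be attained
   arbitrarily close to [0] and equal [u 0]. *)
apply/eqP => T00; apply: nu; exists (u 0) => x.
apply/eqP; rewrite -subr_eq0 -normr_le0; apply/ler_addgt0Pr => e e0; rewrite add0r.
have : \forall t \near 0, `|u t - u 0| < e.
  by have /cvgr_dist_lt/(_ _ e0) := cu 0; apply: filterS => t; rewrite distrC.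
move=> /nbhs_ballP[d /= d0 dd].
have [t St tT] := inf_adherent d0 infS.
have [y yt <-] := periodic_reduce x St.
apply/ltW/dd; rewrite /ball/= sub0r normrN ger0_norm; last by lra.
by move: tT; rewrite -/T -T00 add0r; lra.
Qed.

(** The remainder of [L] modulo [T] would, if positive, be a period smaller than [T]. *)
Lemma principal_period_divides u L T : has_period u L -> principal_period u T ->
  exists2 k : nat, (1 <= k)%N & L = k%:R * T.
Proof.
move=> [L0 uL] [[T0 uT] Tmin].
have [n nT] := periodic_modulo L T0.
have rp : periodic u (L - n%:~R * T).
  by move=> x; rewrite addrA -mulNr -mulrNz periodic_int.
have Ln : L = n%:~R * T.
  apply/eqP; rewrite -subr_eq0 eq_le; apply/andP; split; last by lra.
  rewrite leNgt; apply/negP => r0.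
  by have := Tmin _ (conj r0 rp); lra.
case: n Ln {nT rp} => n Ln; last first.
  by move: L0; rewrite Ln NegzE mulrNz mulNr oppr_gt0 -pmulrn ltNge mulr_ge0// ltW.
exists n; last by rewrite Ln -pmulrn.
by case: n Ln => // Ln; move: L0; rewrite Ln mul0r ltxx.
Qed.

Local Notation mu := (@lebesgue_measure R).

Lemma Rintegral_shift u s a b : continuous u -> a <= b ->
  \int[mu]_(x in `[a + s, b + s]) u x = \int[mu]_(x in `[a, b]) u (x + s).
Proof.
move=> cu ab; rewrite /Rintegral; congr fine.
have d x : is_derive x 1 (fun y => y + s) 1 by apply: is_derive_eq; rewrite addr0.
have dE : (fun y => y + s)^`()%classic = cst 1.
  by apply/funext => x; rewrite derive1E; have [_ ->] := d x.
have cs x : {for x, continuous (fun y => y + s)} by exact: is_derive_continuous (d x).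
rewrite (@integration_by_substitution_increasing _ (fun y => y + s) u)//.
- by apply: eq_integral => x _; rewrite dE /= mulr1.
- by move=> x y _ _; rewrite ltrD2r.
- by rewrite dE => x _; exact: cvg_cst.
- by rewrite dE; exact: is_cvg_cst.
- by rewrite dE; exact: is_cvg_cst.
- split.
  + by move=> x _; have [] := d x.
  + by apply: cvg_at_right_filter; exact: cs.
  + by apply: cvg_at_left_filter; exact: cs.
- exact: continuous_subspaceT.
Qed.

Lemma Rintegral_periodic u T (k : nat) : continuous u -> has_period u T ->
  \int[mu]_(x in `[0, k%:R * T]) u x = k%:R * \int[mu]_(x in `[0, T]) u x.
Proof.
move=> cu [T0 uT].
have int a b : mu.-integrable `[a, b] (EFin \o u).
  apply: continuous_compact_integrable; first exact: segment_compact.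
  exact: continuous_subspaceT.
elim: k => [|k IH]; first by rewrite !mul0r set_itv1 Rintegral_set1.
have kT : 0 <= k%:R * T by rewrite mulr_ge0// ltW.
have E : k.+1%:R * T = T + k%:R * T by rewrite -natr1 mulrDl mul1r addrC.
have shift : \int[mu]_(x in `[k%:R * T, T + k%:R * T]) u x = \int[mu]_(x in `[0, T]) u x.
  rewrite -[X in `[X, _]]add0r Rintegral_shift ?(ltW T0)//.
  by apply: eq_Rintegral => x _; have := periodic_int k x uT; rewrite -pmulrn.
have := @Rintegral_itvB _ u (BLeft 0) (BRight (T + k%:R * T)) (k%:R * T) (int _ _).
rewrite !bnd_simp kT lerDr (ltW T0) => /(_ isT isT).
rewrite Rintegral_itv_obnd_cbnd; last first.
  by apply: integrableS (int (k%:R * T) (T + k%:R * T)) => //; exact: subset_itv_oc_cc.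
by rewrite shift IH E => /eqP; rewrite subr_eq => /eqP ->; rewrite -natr1 mulrDl mul1r addrC.
Qed.

End Orbits.

(** * Counting the families *)

Lemma finite_Sset (R : realType) (L0 L : R) : 0 < L0 -> finite_set (Sset L0 L).
Proof.
(* From [L0 <= L / k] follows [k <= L / L0]; the successor is there because [I_N] excludes [N]. *)
move=> L00; pose N := (Num.truncn (L / L0)).+1.
apply: (@sub_finite_set _ _ ((fun k : nat => L / k%:R) @` `I_N)); last first.
  exact/finite_image/finite_II.
move=> _ [k [k1 -> kL0 _]]; exists k => //=.
have k0 : 0 < k%:R :> R by rewrite ltr0n.
have kL : k%:R <= L / L0 by rewrite ler_pdivlMr// mulrC -ler_pdivlMr.
by rewrite ltnS truncn_ge_nat// (le_trans _ kL)// ltW.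
Qed.

(** Without critical values only the multiples of [2 * pi] remain, and these are stable under
    multiplication by [k]. *)
Lemma Eset_mul (R : realType) (l : R) (k : nat) : (1 <= k)%N ->
  Eset l -> Eset (k%:R * l).
Proof.
move=> k1; rewrite /Eset critical_values0 !set0U => -[j j1 <-].
by exists (k * j)%N; rewrite /= ?muln_gt0 ?k1// natrM; ring.
Qed.

Theorem corollary2p9 (R : realType) (L0 : R) (hL0 : 0 < L0)
    (hnone : forall l : R, 0 < l < L0 ->
       ~ exists (c : R * R) (u : R -> R),
           [/\ Cset c, solution c u, principal_period u l & mean l u = 0])
    (hfin : forall l : R, L0 <= l -> ~ Eset l ->
       Pset l !=set0 /\ finite_set (Pset l))
    (L : R) (hL : L0 <= L) (hLE : ~ Eset L) :
  finite_set (\bigcup_(l in Sset L0 L) Pset l) /\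
  (families L #<= \bigcup_(l in Sset L0 L) Pset l)%card.
Proof.
split.
  apply: bigcup_finite; first exact: finite_Sset.
  by move=> l [k [_ _ lL0 lE]]; have [] := hfin l lL0 lE.
(* Sends [c] to the orbit of some [L]-periodic solution, or to [set0] if there is none. The families
   then lie in its image. *)
pose orbit_of c := xget set0 [set F | exists u, [/\ solution c u,
  has_period u L & F = translation_orbit L u]].
suff sub : families L `<=` orbit_of @` (\bigcup_(l in Sset L0 L) Pset l).
  exact: card_le_trans (subset_card_le sub) (card_image_le _ _).
move=> _ [u [[c cC cu] uL u0] <-].
have cont : continuous u := solution_continuous cu.
have [T uT] : exists T, principal_period u T.
  by case: cu => _ nu _; exact: principal_period_exists cont nu uL.
have [k k1 LkT] := principal_period_divides uL uT.
have kn0 : k%:R != 0 :> R by rewrite pnatr_eq0 -lt0n.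
have [T0 _] := uT.1.
(* The integral over [[0, L]] is [k] times the one over [[0, T]]. *)
have mT : mean T u = 0.
  move: u0; rewrite /mean LkT (Rintegral_periodic _ cont uT.1) => /eqP.
  rewrite !mulf_eq0 invr_eq0 mulf_eq0 (negPf kn0) /= (gt_eqF T0)/= => /eqP ->.
  by rewrite mulr0.
exists c.
  exists T; last by split=> //; exists u.
  exists k; split => //.
  - by rewrite LkT [k%:R * T]mulrC mulfK.
  - rewrite leNgt; apply/negP => TL0.
    by apply: (hnone T); [rewrite T0|exists c, u].
  - by move=> TE; apply: hLE; rewrite LkT; exact: Eset_mul.
(* The chosen solution is a translate of [u], hence has the same orbit; the default is excluded by
   [u] itself. *)
rewrite /orbit_of; case: xgetP => [F -> [v [cv vL ->]]|/(_ (translation_orbit L u))].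
  have [s vs] := solution_translate cC cu uL cv vL.
  by rewrite (funext vs) translation_orbit_shift.
by case; exists u.
Qed.
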